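(* Let $G$ be any connected graph and $k\in\mathbb N$. Every nested set of bonds of $G$, each of order less than $k$, is the set of fundamental cuts of some tree-cut decomposition of $G$.
   Context: A cut of $G$ is the edge set $E(A,B)$ between the parts of a bipartition $\{A,B\}$ of $V(G)$ into nonempty sets (its sides); its order is its size. A bond is a cut both of whose sides induce connected subgraphs. Two cuts are nested if some side of one is contained in some side of the other. A tree-cut decomposition of $G$ is a pair $(T,\mathcal X)$ where $T$ is a tree and $\mathcal X=(X_t)_{t\in V(T)}$ is a family of pairwise disjoint, possibly empty, sets $X_t\subseteq V(G)$ with $\bigcup_t X_t=V(G)$, such that the nodes with nonempty parts are dense in $T$: every edge of $T$ lies on a path in $T$ linking two nodes with nonempty parts. Each edge $t_1t_2$ of $T$ induces the cut $E(\bigcup_{t\in T_1}X_t,\bigcup_{t\in T_2}X_t)$, where $T_1,T_2$ are the components of $T-t_1t_2$; these are the fundamental cuts of $(T,\mathcal X)$. *)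

(* Defs.v *)
From mathcomp Require Import all_boot.
From mathcomp Require Import boolp classical_sets functions cardinality.

Set Implicit Arguments.
Unset Strict Implicit.
Unset Printing Implicit Defensive.

Local Open Scope classical_set_scope.

(* Graphs are simple and may be infinite.  Boolean equality and adjacency cost *)
(* no generality: classically, any type T is an eqType as {classic T} and any  *)
(* Prop-valued relation can be made boolean by asbool.                         *)
Record sgraph := SGraph {
  vertex :> eqType;
  adj : rel vertex;
  adj_sym : symmetric adj;
  adj_irrefl : irreflexive adj }.

Definition linked (V : eqType) (e : rel V) (A : set V) (x y : V) : Prop :=
  exists p : seq V, [/\ path e x p, last x p = y & {in x :: p, forall z, A z}].

(* The subgraph induced by A is connected; as usual the empty graph is not. *)
Definition connected_on (G : sgraph) (A : set G) : Prop :=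
  A !=set0 /\ forall x y, A x -> A y -> linked (@adj G) A x y.

Definition connected_graph (G : sgraph) : Prop := connected_on [set: G].

(* An edge is the 2-element set of its ends. *)
Definition edges_between (G : sgraph) (A B : set G) : set (set G) :=
  [set f | exists x y, [/\ A x, B y, adj x y & f = [set x; y]]].

Definition bipartition (V : Type) (A B : set V) : Prop :=
  [/\ A !=set0, B !=set0, A `&` B = set0 & A `|` B = [set: V]].

Definition cut_with_sides (G : sgraph) (F : set (set G)) (A B : set G) : Prop :=
  bipartition A B /\ F = edges_between A B.

(* When G is connected, a cut determines its two sides. *)
Definition side (G : sgraph) (F : set (set G)) (A : set G) : Prop :=
  exists B, cut_with_sides F A B.

Definition bond (G : sgraph) (F : set (set G)) : Prop :=
  exists A B, [/\ cut_with_sides F A B, connected_on A & connected_on B].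

Definition order_lt (G : sgraph) (F : set (set G)) (k : nat) : Prop :=
  exists2 n, n < k & (F #= `I_n)%card.

Definition nested (G : sgraph) (F F' : set (set G)) : Prop :=
  exists A A', [/\ side F A, side F' A' & A `<=` A' \/ A' `<=` A].

Definition nested_set (G : sgraph) (S : set (set (set G))) : Prop :=
  forall F F', S F -> S F' -> nested F F'.

(* A closed walk of size 2 without repetition just traverses an edge twice.    *)
Definition acyclic (G : sgraph) : Prop :=
  forall c : seq G, ucycle (@adj G) c -> size c <= 2.

Definition tree (T : sgraph) : Prop := connected_graph T /\ acyclic T.

Definition is_path (T : sgraph) (x : T) (p : seq T) (y : T) : bool :=
  [&& path (@adj T) x p, uniq (x :: p) & last x p == y].

Definition on_path (T : sgraph) (t1 t2 x : T) (p : seq T) : bool :=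
  infix [:: t1; t2] (x :: p) || infix [:: t2; t1] (x :: p).

Definition del_edge (T : sgraph) (t1 t2 : T) : rel T :=
  fun u v => adj u v && ((u, v) \notin [:: (t1, t2); (t2, t1)]).

(* The component of T - t1t2 that contains t1; the other one is              *)
(* edge_component t2 t1.                                                      *)
Definition edge_component (T : sgraph) (t1 t2 : T) : set T :=
  [set t | linked (del_edge t1 t2) setT t1 t].

Definition tree_cut_decomposition (G T : sgraph) (X : T -> set G) : Prop :=
  [/\ tree T,
      trivIset [set: T] X,
      \bigcup_(t in [set: T]) X t = [set: G]
    & forall t1 t2 : T, adj t1 t2 ->
        exists x p y, [/\ is_path x p y, on_path t1 t2 x p,
                          X x !=set0 & X y !=set0]].

Definition fundamental_cut (G T : sgraph) (X : T -> set G) (t1 t2 : T) :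
    set (set G) :=
  edges_between (\bigcup_(t in edge_component t1 t2) X t)
                (\bigcup_(t in edge_component t2 t1) X t).

Definition fundamental_cuts (G T : sgraph) (X : T -> set G) :
    set (set (set G)) :=
  [set F | exists t1 t2 : T, adj t1 t2 /\ F = fundamental_cut X t1 t2].

(* Main.v *)
(** Fix a vertex [r].  For a bond in the given set [S] take its side avoiding
    [r]: nestedness makes these sides, together with the whole vertex set, a
    laminar family, i.e. two members that meet are comparable.  A vertex [x]
    lies in only finitely many of them: they all separate [x] from [r] by
    fewer than [k] edges, and both they and their complements are connected.
    So the Hasse diagram of the family is a tree.  Giving each member the
    vertices that lie in none of its proper submembers, the edge above a
    member [A] induces the cut between [A] and its complement. *)
Require Import Defs.
From mathcomp Require Import all_boot finmap.
From mathcomp Require Import boolp classical_sets functions cardinality.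

Local Open Scope classical_set_scope.

Set Implicit Arguments.
Unset Strict Implicit.
Unset Printing Implicit Defensive.

(** * Walks, and finiteness of the separators of bounded order *)

Section Linked.
Variable V : eqType.
Implicit Types (e : rel V) (A B P : set V).

Lemma linked_mono e e' A B x y :
  (forall u v, A u -> A v -> e u v -> e' u v) -> A `<=` B ->
  linked e A x y -> linked e' B x y.
Proof.
move=> ee' AB [p [xp yp Ap]]; exists p; split=> //; last first.
  by move=> z /Ap /AB.
elim: p x xp {yp} Ap => //= u p IHp x /andP[xu up] Ap.
rewrite ee' ?IHp //; first by move=> z zp; apply: Ap; rewrite inE zp orbT.
  by apply: Ap; rewrite mem_head.
by apply: Ap; rewrite !inE eqxx orbT.
Qed.

Lemma linked_trans e A x y z : linked e A x y -> linked e A y z -> linked e A x z.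
Proof.
move=> [p [xp yp Ap]] [q [yq zq Aq]]; exists (p ++ q).
rewrite cat_path last_cat yp xp; split=> // u; rewrite -cat_cons mem_cat.
by case/orP=> [/Ap //|uq]; apply: Aq; rewrite inE uq orbT.
Qed.

Lemma linked_sym e A x y : symmetric e -> linked e A x y -> linked e A y x.
Proof.
move=> esym [p [xp yp Ap]]; exists (rev (belast x p)); split.
- by rewrite -yp rev_path; under eq_path do rewrite esym.
- by case: p {xp Ap} yp => //= u p _; rewrite rev_cons last_rcons.
- move=> z; rewrite -[y]yp -rev_rcons -lastI mem_rev; exact: Ap.
Qed.

Lemma linked_closed e A P x y :
  (forall u v, A u -> A v -> e u v -> P u -> P v) ->
  linked e A x y -> P x -> P y.
Proof.
move=> eP [p [xp <- Ap]]; elim: p x xp Ap => //= u p IHp x /andP[xu up] Ap Px.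
apply: IHp => //; first by move=> z zp; apply: Ap; rewrite inE zp orbT.
by apply: eP xu Px; apply: Ap; rewrite !inE eqxx ?orbT.
Qed.

Lemma path_crossing e A x p :
  path e x p -> A x -> ~ A (last x p) ->
  exists2 uv, uv \in zip (x :: p) p & [/\ e uv.1 uv.2, A uv.1 & ~ A uv.2].
Proof.
elim: p x => //= u p IHp x /andP[xu up] Ax nAl.
have [Au|nAu] := pselect (A u).
  by have [uv uvp H] := IHp _ up Au nAl; exists uv; rewrite // inE uvp orbT.
by exists (x, u); rewrite ?mem_head.
Qed.

(** The relation [e] is a parameter because the induction on [k] deletes edges. A list of outward
    pairs bounds the boundary, rather than a cardinality, so that deleting an edge just removes an
    entry. *)
Definition separators e x y k : set (set V) :=
  [set A | [/\ A x, ~ A y,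
     forall u v, A u -> A v -> linked e A u v,
     forall u v, ~ A u -> ~ A v -> linked e (~` A) u v
   & exists2 s : seq (V * V), size s <= k &
       forall u v, A u -> ~ A v -> e u v -> (u, v) \in s]].

(** A vertex linked to [x] but outside [A] would link [x] to [y] through the complement, so the
    component of [x] is the only candidate. *)
Lemma finite_separators_unlinked k e x y :
  ~ linked e setT x y -> finite_set (separators e x y k).
Proof.
move=> nxy; apply: (@sub_finite_set _ _ [set [set z | linked e setT x z]]) => //.
move=> A [Ax nAy Ac nAc _]; apply/seteqP; split=> z /=.
  by move=> Az; apply: linked_mono (Ac _ _ Ax Az).
move=> xz; apply: contrapT => nAz; apply: nxy; apply: linked_trans xz _.
exact: linked_mono (nAc _ _ nAz nAy).
Qed.

(* If a path joins [x] to [y], every separator cuts one of its finitely many *)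
(* edges, and deleting that edge leaves a separator of smaller order.        *)
Lemma finite_separators k e x y : symmetric e -> finite_set (separators e x y k).
Proof.
elim: k e => [|k IHk] e esym;
  have [[p [xp yp _]]|] := pselect (linked e setT x y);
  try exact: finite_separators_unlinked.
  (* For [k = 0] no edge may leave [A], yet the walk from [x] to [y] has to. *)
  apply: (@sub_finite_set _ _ set0) => // A [Ax nAy _ _ [[|//] _ sA]].
  rewrite -yp in nAy.
  by have [uv _ [euv Au nAv]] := path_crossing xp Ax nAy; have := sA _ _ Au nAv euv.
apply: (@sub_finite_set _ _ (\bigcup_(uv in [set` zip (x :: p) p])
  [set A | separators e x y k.+1 A /\ [/\ e uv.1 uv.2, A uv.1 & ~ A uv.2]])).
  move=> A sA; have [Ax nAy _ _ _] := sA; rewrite -yp in nAy.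
  by have [uv uvp H] := path_crossing xp Ax nAy; exists uv.
apply: bigcup_finite => // -[u v] _ /=.
pose e' a b := e a b && ((a, b) \notin [:: (u, v); (v, u)]).
apply: sub_finite_set (IHk e' _); last first.
  move=> a b; rewrite /e' esym !inE !xpair_eqE orbC.
  by rewrite [(a == v) && _]andbC [(a == u) && _]andbC.
(* The deleted edge joins [A] to its complement, so walks inside either side survive. *)
move=> A [[Ax nAy Ac nAc [s sk sA]] [uv Au nAv]]; split=> //.
- move=> a b Aa Ab; apply: linked_mono (Ac _ _ Aa Ab) => // c d Acc Ad cd.
  rewrite /e' cd /= !inE !xpair_eqE; apply/negP.
  by case/orP=> /andP[/eqP ? /eqP ?]; subst.
- move=> a b Aa Ab; apply: linked_mono (nAc _ _ Aa Ab) => // c d Acc Ad cd.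
  rewrite /e' cd /= !inE !xpair_eqE; apply/negP.
  by case/orP=> /andP[/eqP ? /eqP ?]; subst.
- exists (rem (u, v) s); first by rewrite size_rem ?sA //; case: (size s) sk.
  move=> a b Aa nAb /andP[ab]; rewrite !inE negb_or => /andP[ne _].
  have := sA a b Aa nAb ab.
  by rewrite (perm_mem (perm_to_rem (sA u v Au nAv uv))) inE (negPf ne).
Qed.

End Linked.

(** * Cuts and their sides *)

Section Cuts.
Variable G : sgraph.
Implicit Types (A B : set G) (F : set (set G)).

Lemma edges_betweenC A B : edges_between A B = edges_between B A.
Proof.
by apply/seteqP; split=> f [x [y [? ? ? ->]]]; exists y, x;
  rewrite adj_sym setUC.
Qed.

Lemma bipartition_setC A B : bipartition A B -> B = ~` A.
Proof.
case=> _ _ AB0 ABT; apply/seteqP; split=> z.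
  by move=> Bz Az; have : set0 z by rewrite -AB0.
by move=> nAz; have [//|] : (A `|` B) z by rewrite ABT.
Qed.

Lemma mem_edges_between A x y : adj x y -> A x ->
  edges_between A (~` A) [set x; y] <-> ~ A y.
Proof.
move=> xy Ax; split; last by move=> nAy; exists x, y.
move=> [a [b [Aa nAb ab E]]] Ay.
have [|] : [set x; y] b by rewrite E; right.
  by move=> bx; apply: nAb; rewrite bx.
by move=> bx; apply: nAb; rewrite bx.
Qed.

(** A walk changes sides exactly at the edges of the cut, so agreement of [A] and [B] at [r] spreads
    along walks to every vertex. *)
Lemma edges_between_inj A B r : connected_graph G -> ~ A r -> ~ B r ->
  edges_between A (~` A) = edges_between B (~` B) -> A = B.
Proof.
move=> [_ Gc] nAr nBr E; apply/seteqP; suff H x : A x <-> B x by split=> x /H.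
have rx := Gc r x I I.
apply: (@linked_closed _ _ _ [set z | A z <-> B z] _ _ _ rx) => //=.
move=> u v _ _ uv ABu.
have [Au|nAu] := pselect (A u).
  have Bu := ABu.1 Au.
  have := mem_edges_between uv Au; have := mem_edges_between uv Bu; rewrite E.
  by have [?|?] := pselect (A v); have [?|?] := pselect (B v); tauto.
(* Outside both sets the same argument runs for the complements, which have the same cuts. *)
have nBu : ~ B u by tauto.
have := mem_edges_between uv (nAu : (~` A) u).
have := mem_edges_between uv (nBu : (~` B) u).
rewrite !setCK ![edges_between (~` _) _]edges_betweenC E /setC /=.
by have [?|?] := pselect (A v); have [?|?] := pselect (B v); tauto.
Qed.

(** Turns the bound on the order into the list form that [separators] asks for. *)
Lemma order_lt_boundary A k : order_lt (edges_between A (~` A)) k ->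
  exists2 s : seq (G * G), size s <= k &
    forall u v, A u -> ~ A v -> adj u v -> (u, v) \in s.
Proof.
move=> [n nk /card_set_bijP[f [fn finj _]]].
(* [h] decodes the numbering [f] of the cut: the number determines the edge, and the end in [A] its
   orientation. [None] serves numbers carried by no edge. *)
have /choice[h hP] (i : nat) : exists o : option (G * G), forall u v,
    A u -> ~ A v -> adj u v -> f [set u; v] = i -> o = Some (u, v).
  have [[[u v] [Au nAv uv fi]]|nuv] := pselect (exists uv : G * G,
      [/\ A uv.1, ~ A uv.2, adj uv.1 uv.2 & f [set uv.1; uv.2] = i]); last first.
    by exists None => u v Au nAv uv fi; case: nuv; exists (u, v).
  exists (Some (u, v)) => a b Aa nAb ab; rewrite -fi => /esym/finj E.
  have {}E : [set u; v] = [set a; b].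
    by apply: E; rewrite inE; [exists u, v|exists a, b].
  have [ua|ub] : [set a; b] u by rewrite -E; left.
    have [vx|vb] : [set a; b] v by rewrite -E; right.
      by case: nAv; rewrite vx.
    by rewrite ua vb.
  by case: nAb; rewrite -ub.
exists (pmap h (iota 0 n)).
  by rewrite size_pmap (leq_trans (count_size _ _)) // size_iota ltnW.
move=> u v Au nAv uv; rewrite mem_pmap; apply/mapP.
exists (f [set u; v]); last by rewrite (hP _ _ _ Au nAv uv erefl).
by rewrite mem_iota /=; apply: fn; exists u, v.
Qed.

End Cuts.

(** * Depth and parents in a laminar family *)

Section LaminarTree.
Variables (G : sgraph) (fam : set (set G)) (r : G).
Hypothesis famT : fam setT.
Hypothesis fam_nonempty : forall A, fam A -> A !=set0.
Hypothesis fam_laminar : forall A B x,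
  fam A -> fam B -> A x -> B x -> A `<=` B \/ B `<=` A.
Hypothesis fam_finite : forall x, finite_set [set A | fam A /\ A x].
Hypothesis fam_root : forall A, fam A -> A r -> A = setT.
Implicit Types A B C : set G.

Lemma properset_neq A B : A `<=` B -> A <> B -> A `<` B.
Proof. by move=> AB nAB; split=> // BA; apply: nAB; apply/seteqP. Qed.

(** The level in the future tree, with the root at 1. [fset_set] is meaningful only on finite sets,
    hence [finite_above]. *)
Definition depth A := #|` fset_set [set B | fam B /\ A `<=` B]|.

Lemma above_sub A x : A x ->
  [set B | fam B /\ A `<=` B] `<=` [set B | fam B /\ B x].
Proof. by move=> Ax B [fB AB]; split=> //; apply: AB. Qed.

Lemma finite_above A : fam A -> finite_set [set B | fam B /\ A `<=` B].
Proof.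
move=> /fam_nonempty[x Ax]; apply: sub_finite_set (fam_finite x).
exact: above_sub.
Qed.

(** Whatever contains [B] contains [A], while [A] itself contains [A] but not [B]. *)
Lemma depth_ltn A B : fam A -> fam B -> A `<` B -> depth B < depth A.
Proof.
move=> fA fB [sAB nBA]; apply: fproper_ltn_card.
rewrite fproperEneq; apply/andP; split; last first.
  rewrite -fset_set_sub; try exact: finite_above.
  by move=> C [fC BC]; split=> //; apply: subset_trans BC.
apply/eqP => /(fset_set_inj (finite_above fB) (finite_above fA)) E.
have [_ BA] : [set C | fam C /\ B `<=` C] A by rewrite E; split.
exact: nBA BA.
Qed.

(** The members through [x] form a finite chain, which bounds their depths; a member of [D] of
    greatest depth is the least one. *)
Lemma fam_min (D : set (set G)) x : D !=set0 ->
  (forall A, D A -> fam A /\ A x) ->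
  exists2 A, D A & forall B, D B -> A `<=` B.
Proof.
move=> [A0 DA0] DP.
pose P n := `[< exists2 A, D A & depth A = n >].
have [||n /asboolP[A DA <-] Amax] := @ex_maxnP P #|` fset_set [set A | fam A /\ A x]|.
- by exists (depth A0); apply/asboolP; exists A0.
- move=> n /asboolP[A /DP[fA Ax] <-]; apply: fsubset_leq_card.
  by rewrite -fset_set_sub //; [exact: above_sub|exact: finite_above].
exists A => // B DB; have [[fA Ax] [fB Bx]] := (DP A DA, DP B DB).
have [//|BA] := fam_laminar fA fB Ax Bx.
have [->//|/(properset_neq BA)/(depth_ltn fB fA)] := pselect (B = A).
by rewrite ltnNge Amax //; apply/asboolP; exists B.
Qed.

(** The covering relation, stated as being least among the strict supersets rather than as having
    nothing in between; this makes uniqueness immediate. *)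
Definition parent A B :=
  [/\ fam B, A `<` B & forall C, fam C -> A `<` C -> B `<=` C].

Lemma parent_exists A : fam A -> A <> setT -> exists B, parent A B.
Proof.
move=> fA AT; have [x Ax] := fam_nonempty fA.
have [||B [fB AB] Bmin] := @fam_min [set B | fam B /\ A `<` B] x.
- by exists setT; split=> //; apply: properset_neq.
- by move=> B [fB [AB _]]; split=> //; apply: AB.
by exists B; split=> // C fC AC; apply: Bmin.
Qed.

Lemma parent_inj A B C : parent A B -> parent A C -> B = C.
Proof.
move=> [fB AB Bmin] [fC AC Cmin]; apply/seteqP.
by split; [apply: Bmin|apply: Cmin].
Qed.

Lemma parent_irrefl A : ~ parent A A.
Proof. by case=> _ [_ []]. Qed.

(** * The Hasse diagram as an acyclic graph *)

Definition node : eqType := set_type fam.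

Lemma node_fam (t : node) : fam (val t).
Proof. exact: set_mem (valP t). Qed.

Definition node_of A (fA : fam A) : node := exist _ A (mem_set fA).

Definition node_adj : rel node :=
  fun s t => `[< parent (val s) (val t) \/ parent (val t) (val s) >].

Lemma node_adj_sym : symmetric node_adj.
Proof. by move=> s t; apply/asboolP/asboolP => -[]; [right|left|right|left]. Qed.

Lemma node_adj_irrefl : irreflexive node_adj.
Proof. by move=> s; apply/asboolP => -[] /parent_irrefl. Qed.

Definition laminar_graph : sgraph := SGraph node_adj_sym node_adj_irrefl.
Notation T := laminar_graph.

(** By laminarity, these are the vertices whose least member is [t]. A bag is empty when smaller
    members cover [t]. *)
Definition bag (t : T) : set G :=
  [set x | val t x /\ forall B, fam B -> B `<` val t -> ~ B x].

(** Pass to parents repeatedly: the parent of a proper subset of [t] is still inside [t], and depth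
    drops. The bounds on the nodes visited show that paths are simple and avoid given edges. *)
Lemma climb (s t : T) : val s `<=` val t ->
  exists p, [/\ path (@adj T) s p, uniq (s :: p), last s p = t
    & {in s :: p, forall z, val s `<=` val z /\ val z `<=` val t}].
Proof.
have [n] := ubnP (depth (val s)); elim: n s => // n IHn s sn st.
have [ <-|nst] := pselect (s = t).
  by exists [::]; split=> // z; rewrite mem_seq1 => /eqP->; split.
have {}nst : val s `<` val t by apply: properset_neq => // /val_inj.
have [|B sB] := parent_exists (node_fam s).
  by move=> sT; case: nst => _; apply; rewrite sT.
have [fB sltB Bmin] := sB; have Bt := Bmin _ (node_fam t) nst.
have [|p [Bp up pt pP]] := IHn (node_of fB) _ Bt.
  by rewrite -ltnS (leq_trans _ sn) // ltnS; apply: depth_ltn => //; exact: node_fam.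
exists (node_of fB :: p); split=> //.
- by rewrite /= Bp andbT; apply/asboolP; left.
- rewrite cons_uniq up andbT; apply/negP => /pP[/= Bs _].
  exact: sltB.2 Bs.
- move=> z; rewrite inE => /orP[/eqP->//|/pP[/= Bz zt]]; split=> //.
  by apply: subset_trans Bz; case: sltB.
Qed.

Definition root : T := node_of famT.

Lemma linked_root (t : T) : linked (@adj T) setT t root.
Proof. by have [p [tp _ pr _]] := @climb t root (@subsetT _ _); exists p. Qed.

Lemma seq_argmax (U : eqType) (f : U -> nat) (c : seq U) : c != [::] ->
  exists2 t, t \in c & {in c, forall s, f s <= f t}.
Proof.
elim: c => // x [|y c] IHc _.
  by exists x => [|s]; rewrite mem_seq1 // => /eqP->.
have [//|t tc tmax] := IHc; have [xt|tx] := leqP (f x) (f t).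
  exists t; first by rewrite inE tc orbT.
  by move=> s; rewrite inE => /orP[/eqP->|/tmax].
exists x; first exact: mem_head.
move=> s; rewrite inE => /orP[/eqP->//|/tmax st].
exact: leq_trans st (ltnW tx).
Qed.

(** Both neighbours of a deepest node on a cycle must be its unique parent, so they coincide. *)
Lemma acyclic_laminar : acyclic T.
Proof.
move=> c0 /andP[cyc uc]; have [->//|c0n] := eqVneq c0 [::].
have [t tc tmax] := seq_argmax (fun s : T => depth (val s)) c0n.
have up (s : T) : s \in c0 -> adj t s -> parent (val t) (val s).
  move=> /tmax st /asboolP[//|[_ lt _]].
  by have := depth_ltn (node_fam s) (node_fam t) lt; rewrite ltnNge st.
have [i p Ec] := rot_to tc.
have mp s : s \in p -> s \in c0 by move=> sp; rewrite -(mem_rot i) Ec inE sp orbT.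
rewrite -(size_rot i) Ec; move: cyc uc; rewrite -(rot_cycle i) -(rot_uniq i) Ec.
(* The cycle now starts at the deepest node [t]. Unless it has at most two nodes, [u] and [s] are
   the nodes after and before [t]. *)
case/lastP: p mp {Ec} => // p s mp.
case: p mp => [//|u p] mp /= /andP[tu]; rewrite rcons_path => /andP[_].
rewrite last_rcons node_adj_sym => st /andP[_].
have su : s = u.
  apply: val_inj; apply: (@parent_inj (val t)); apply: up => //; apply: mp.
    by rewrite mem_rcons mem_head.
  by rewrite mem_head.
by rewrite su mem_rcons mem_head.
Qed.

(** * Components left by deleting a tree edge *)

Lemma del_edge_sym (H : sgraph) (s t : H) : symmetric (del_edge s t).
Proof.
move=> u v; rewrite /del_edge adj_sym !inE !xpair_eqE orbC.
by rewrite [(u == t) && _]andbC [(u == s) && _]andbC.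
Qed.

Lemma del_edgeC (H : sgraph) (s t : H) : del_edge s t = del_edge t s.
Proof.
by apply/funext => u; apply/funext => v; rewrite /del_edge !inE orbC.
Qed.

(** The deleted edge is the only one leaving the nodes below [s]: the parent of any other such node
    is still below [s]. Conversely, each of them climbs to [s]. *)
Lemma edge_component_down (s t : T) : parent (val s) (val t) ->
  edge_component s t = [set z : T | val z `<=` val s].
Proof.
move=> st; have [ft [sst nts] tmin] := st.
apply/seteqP; split=> z /= sz.
  apply: (@linked_closed _ _ _ [set z : T | val z `<=` val s] _ _ _ sz) => //.
  move=> u v _ _ /andP[/asboolP uv nuv] /= us.
  case: uv => [uv|[_ [vu _] _]]; last exact: subset_trans vu us.
  have [Eus|nus] := pselect (u = s).
    case/negP: nuv; rewrite Eus in uv *.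
    by rewrite (val_inj (parent_inj uv st)) mem_head.
  have [_ _ umin] := uv; apply: umin; first exact: node_fam.
  by apply: properset_neq => // /val_inj.
apply: linked_sym; first exact: del_edge_sym.
have [p [zp _ ps pP]] := climb sz.
suff : linked (del_edge s t) [set z : T | val z `<=` val s] z s.
  exact: linked_mono.
have : linked (@adj T) [set z : T | val z `<=` val s] z s.
  by exists p; split=> // u /pP[].
apply: linked_mono => // u v /= us vs uv; apply/andP; split=> //.
rewrite !inE !xpair_eqE; apply/negP.
by case/orP=> /andP[/eqP ? /eqP ?]; subst.
Qed.

(** Nodes not below [s] climb to the root without meeting a node below [s], so the root links them
    all to [t]. *)
Lemma edge_component_up (s t : T) : parent (val s) (val t) ->
  edge_component t s = [set z : T | ~ val z `<=` val s].
Proof.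
move=> st; have [ft [sst nts] tmin] := st.
have to_root (z : T) : ~ val z `<=` val s -> linked (del_edge t s) setT z root.
  move=> nzs; have [p [zp _ pr pP]] := @climb z root (@subsetT _ _).
  suff : linked (del_edge t s) [set z : T | ~ val z `<=` val s] z root.
    exact: linked_mono.
  have : linked (@adj T) [set z : T | ~ val z `<=` val s] z root.
    by exists p; split=> // u /pP[zu _] us; apply: nzs; apply: subset_trans us.
  apply: linked_mono => // u v /= us vs uv; apply/andP; split=> //.
  rewrite !inE !xpair_eqE; apply/negP.
  by case/orP=> /andP[/eqP E1 /eqP E2]; [apply: vs; rewrite E2|apply: us; rewrite E1].
apply/seteqP; split=> z /= tz; last first.
  apply: linked_trans (to_root t nts) _.
  by apply: linked_sym; [exact: del_edge_sym|exact: to_root].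
(* A node below [s] is linked to [s]; were it also linked to [t], then [t] would lie below [s]. *)
move=> zs; have : edge_component s t z by rewrite edge_component_down.
rewrite /edge_component /= del_edgeC => sz.
suff : edge_component s t t by rewrite edge_component_down.
rewrite /edge_component /= del_edgeC; apply: linked_trans sz _.
by apply: linked_sym tz; exact: del_edge_sym.
Qed.

(** * Bags and the cuts they induce *)

Lemma bag_exists x : exists t : T, bag t x.
Proof.
have [|//|A [fA Ax] Amin] := @fam_min [set A | fam A /\ A x] x.
  by exists setT.
by exists (node_of fA); split=> // B fB [_ nAB] Bx; apply: nAB; apply: Amin.
Qed.

Lemma bag_sub (s t : T) x : val s x -> bag t x -> val t `<=` val s.
Proof.
move=> sx [tx tmin]; have fs := node_fam s.
have [st|//] := fam_laminar fs (node_fam t) sx tx.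
have [->//|ne] := pselect (val s = val t).
by case: (tmin _ fs (properset_neq st ne) sx).
Qed.

Lemma bag_inj (s t : T) x : bag s x -> bag t x -> s = t.
Proof.
move=> sx tx; apply: val_inj; apply/seteqP; split.
  by apply: bag_sub sx; case: tx.
by apply: bag_sub tx; case: sx.
Qed.

Lemma bigcup_bag_down (s : T) :
  \bigcup_(z in [set z : T | val z `<=` val s]) bag z = val s.
Proof.
apply/seteqP; split=> [x [z /= zs [zx _]]|x sx]; first exact: zs.
by have [t tx] := bag_exists x; exists t => //=; apply: bag_sub tx.
Qed.

Lemma bigcup_bag_up (s : T) :
  \bigcup_(z in [set z : T | ~ val z `<=` val s]) bag z = ~` val s.
Proof.
apply/seteqP; split=> [x [z /= zs zx] sx|x nsx].
  by apply: zs; apply: bag_sub zx.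
have [t tx] := bag_exists x; exists t => //= ts.
by apply: nsx; apply: ts; case: tx.
Qed.

Lemma fundamental_cut_parent (s t : T) : parent (val s) (val t) ->
  fundamental_cut bag s t = edges_between (val s) (~` val s).
Proof.
move=> st; rewrite /fundamental_cut edge_component_down // edge_component_up //.
by rewrite bigcup_bag_down bigcup_bag_up.
Qed.

Lemma fundamental_cutC (s t : T) : fundamental_cut bag s t = fundamental_cut bag t s.
Proof. exact: edges_betweenC. Qed.

(** Makes the part at the root nonempty, so that the root can end the paths required for density. *)
Lemma bag_root : bag root r.
Proof. by split=> // B fB [_ nB] /(fam_root fB) BT; apply: nB; rewrite BT. Qed.

(** The bag of [s] may be empty, so the path starts at the node whose bag holds some vertex [v] of
    [s], climbs to [s], crosses to [t] and goes on to the root. *)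
Lemma parent_on_path (s t : T) : parent (val s) (val t) ->
  exists x p, [/\ is_path x p root, on_path s t x p & bag x !=set0].
Proof.
move=> [ft [sst nts] tmin].
have [v sv] := fam_nonempty (node_fam s); have [x xv] := bag_exists v.
have [p [xp up ps pP]] := climb (bag_sub sv xv).
have [q [tq uq qr qP]] := @climb t root (@subsetT _ _).
exists x, (p ++ t :: q); split; last by exists v.
  rewrite /is_path cat_path last_cat xp /= ps tq qr eqxx !andbT.
  apply/andP; split.
    by apply/asboolP; left; split.
  rewrite -[_ && _]/(uniq ((x :: p) ++ t :: q)) cat_uniq up uq andbT andTb.
  (* The first half stays inside [s] and the second contains [t], so they share no node. *)
  apply/hasPn => z /qP[tz _]; apply/negP => /pP[_ zs].
  by apply: nts; apply: subset_trans zs.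
rewrite /on_path; apply/orP; left; apply/infixP.
by exists (belast x p), q; rewrite -cat_cons lastI ps cat_rcons.
Qed.

Lemma adj_on_path (s t : T) : adj s t ->
  exists x p y, [/\ is_path x p y, on_path s t x p, bag x !=set0 & bag y !=set0].
Proof.
have r0 : bag root !=set0 by exists r; exact: bag_root.
move=> /asboolP[] /parent_on_path[x [p [xp st x0]]]; exists x, p, root => //.
by split=> //; rewrite /on_path orbC.
Qed.

Lemma laminar_tree_cut_decomposition : tree_cut_decomposition bag.
Proof.
split.
- split; last exact: acyclic_laminar.
  split; first by exists root.
  move=> s t _ _; apply: linked_trans (linked_root s) _.
  by apply: linked_sym (linked_root t); exact: node_adj_sym.
- by move=> s t _ _ [x [sx tx]]; exact: bag_inj sx tx.
- by apply/seteqP; split=> // x _; have [t tx] := bag_exists x; exists t.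
- exact: adj_on_path.
Qed.

(** Each edge joins a member to its parent, and each member but the whole set has a parent. *)
Lemma fundamental_cuts_laminar : fundamental_cuts bag =
  [set F | exists A, [/\ fam A, A <> setT & F = edges_between A (~` A)]].
Proof.
apply/seteqP; split=> F /=.
  have parentP (s t : T) : parent (val s) (val t) ->
      F = fundamental_cut bag s t ->
      exists A, [/\ fam A, A <> setT & F = edges_between A (~` A)].
    move=> st ->; exists (val s); split; [exact: node_fam| |exact: fundamental_cut_parent].
    by move=> sT; case: st => _ [_ nts] _; apply: nts; rewrite sT.
  move=> [s [t [/asboolP[st|st]]]]; first exact: parentP.
  by rewrite fundamental_cutC; exact: parentP.
move=> [A [fA AT ->]]; have [B AB] := parent_exists fA AT.
have [fB _ _] := AB; exists (node_of fA), (node_of fB).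
split; first by apply/asboolP; left.
by rewrite fundamental_cut_parent.
Qed.

End LaminarTree.

(** * From nested bonds to a laminar family *)

Theorem theorem4p3 (G : sgraph) (k : nat) (S : set (set (set G))) :
  connected_graph G ->
  (forall F, S F -> bond F /\ order_lt F k) ->
  nested_set S ->
  exists (T : sgraph) (X : T -> set G),
    tree_cut_decomposition X /\ fundamental_cuts X = S.
Proof.
move=> Gconn Sbond Snested; have [[r _] Glink] := Gconn.
pose fam : set (set G) :=
  [set A | A = setT \/ S (edges_between A (~` A)) /\ ~ A r].
have SP F : S F -> exists A, [/\ F = edges_between A (~` A), ~ A r, A !=set0,
    forall u v, A u -> A v -> linked (@adj G) A u v
  & forall u v, ~ A u -> ~ A v -> linked (@adj G) (~` A) u v].
  move=> /Sbond[[A [B [[AB ->] [A0 Ac] [B0 Bc]]]] _].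
  have EB := bipartition_setC AB; rewrite EB in B0 Bc *.
  have [Ar|nAr] := pselect (A r); last by exists A.
  exists (~` A); rewrite setCK edges_betweenC; split=> // u v.
  by move=> /contrapT Au /contrapT Av; apply: Ac.
(* [nested] only supplies some sides; as a cut of a connected graph determines its sides, each is
   the chosen one or its complement. *)
have sideP A C : ~ A r -> side (edges_between A (~` A)) C -> C = A \/ C = ~` A.
  move=> nAr [B [CB E]]; rewrite (bipartition_setC CB) in E.
  have [Cr|nCr] := pselect (C r); last first.
    by left; apply: edges_between_inj Gconn nCr nAr _; rewrite E.
  right; rewrite -[C]setCK; congr (~` _).
  apply: edges_between_inj Gconn _ nAr _; first by move=> /(_ Cr).
  by rewrite setCK edges_betweenC E.
have famP A : S (edges_between A (~` A)) -> ~ A r ->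
    [/\ A !=set0, forall u v, A u -> A v -> linked (@adj G) A u v
  & forall u v, ~ A u -> ~ A v -> linked (@adj G) (~` A) u v].
  move=> /SP[B [E nBr B0 Bc nBc]] nAr.
  by rewrite (edges_between_inj Gconn nAr nBr E).
have famT : fam setT by left.
have fam_nonempty A : fam A -> A !=set0.
  by case=> [->|[SA nAr]]; [exists r|case: (famP A SA nAr)].
have fam_laminar A B x : fam A -> fam B -> A x -> B x -> A `<=` B \/ B `<=` A.
  case=> [->|[SA nAr]]; first by right.
  case=> [->|[SB nBr]]; first by left.
  move=> Ax Bx; have [C [D [/(sideP _ _ nAr) EC /(sideP _ _ nBr) ED]]] := Snested _ _ SA SB.
  (* Since [x] lies in both sets and [r] in neither, no inclusion holds between one set and the
     complement of the other; an inclusion of complements reverses. *)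
  case: EC => ->; case: ED => -> CD.
  - exact: CD.
  - by case: CD => [/(_ x Ax)|/(_ r nBr)].
  - by case: CD => [/(_ r nAr)|/(_ x Bx)].
  - by case: CD => /subsetC; rewrite !setCK; [right|left].
have fam_finite x : finite_set [set A | fam A /\ A x].
  (* Every member through [x] other than the whole set separates [x] from [r] with at most [k]
     boundary edges. *)
  apply: (@sub_finite_set _ _ ([set setT] `|` separators (@adj G) x r k)).
    move=> A [[->|[SA nAr]] Ax]; [by left|right].
    have [_ Ac nAc] := famP A SA nAr; split=> //.
    by apply: order_lt_boundary; case: (Sbond _ SA).
  rewrite finite_setU; split; first exact: finite_set1.
  by apply: finite_separators; exact: adj_sym.
have fam_root A : fam A -> A r -> A = setT by case=> [|[]].
exists (laminar_graph fam), (@bag G fam); split.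
  exact: (@laminar_tree_cut_decomposition G fam r).
rewrite fundamental_cuts_laminar //; apply/seteqP; split=> F /=.
  by move=> [A [[//|[SA _]] _ ->]].
move=> SF; have [A [E nAr _ _ _]] := SP F SF; exists A; split=> //.
  by right; rewrite -E.
by move=> AT; apply: nAr; rewrite AT.
Qed.
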